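(* Let $T\in\mathbb{R}^{n\times n}$ denote the $(1,1)$ block of the inverse of $\mathcal{K}=\begin{pmatrix} A-k^2M & B^T\\ B & 0\end{pmatrix}$. For any real $\eta\neq k^2$, it holds that $$T=(A+\eta B^TL^{-1}B-k^2M)^{-1}(I-B^TL^{-1}C^T)=(A+\eta B^TL^{-1}B-k^2M)^{-1}-\frac{1}{\eta-k^2}\,CL^{-1}C^T .$$
   Context: Let $m\le n$ and let $k$ be a real number. $A\in\mathbb{R}^{n\times n}$ is symmetric positive semidefinite with $\dim\ker(A)=m$; $M\in\mathbb{R}^{n\times n}$ is symmetric positive definite; $B\in\mathbb{R}^{m\times n}$ has full row rank; $C\in\mathbb{R}^{n\times m}$ is a matrix whose columns form a basis of $\ker(A)$ (so $AC=0$) and satisfies $MC=B^T$; and $L=BC\in\mathbb{R}^{m\times m}$ (so $L=C^TMC$ is symmetric positive definite). Then $\mathbb{R}^n=\ker(A)\oplus\ker(B)$. Standing assumption: both $\mathcal{K}$ and $A-k^2M$ are nonsingular. Under these assumptions $A+\eta B^TL^{-1}B-k^2M$ is nonsingular for every real $\eta\ne k^2$. *)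

(* Defs.v *)
From mathcomp Require Import all_boot all_order all_algebra.
Set Implicit Arguments.
Unset Strict Implicit.
Unset Printing Implicit Defensive.
Import Order.TTheory GRing.Theory Num.Theory.
Local Open Scope ring_scope.

Definition sym_posdef (R : numDomainType) (n : nat) (M : 'M[R]_n) : Prop :=
  M^T = M /\ forall x : 'cV[R]_n, x != 0 -> 0 < (x^T *m M *m x) 0 0.

Definition sym_possemidef (R : numDomainType) (n : nat) (A : 'M[R]_n) : Prop :=
  A^T = A /\ forall x : 'cV[R]_n, 0 <= (x^T *m A *m x) 0 0.

(* MathComp's [kermx A] is the left kernel {u | u *m A = 0}; this is the right
   kernel {x | A *m x = 0}, as a subspace of the column vectors. *)
Definition colker (F : fieldType) (m n : nat) (A : 'M[F]_(m, n)) :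
    {vspace 'cV[F]_n} :=
  lker (linfun (mulmx A : 'cV[F]_n -> 'cV[F]_m)).

Definition saddle_mx (R : pzRingType) (m n : nat) (k : R) (A M : 'M[R]_n)
    (B : 'M[R]_(m, n)) : 'M[R]_(n + m) :=
  block_mx (A - k ^+ 2 *: M) B^T B 0.

(* Main.v *)
(* Comparing blocks in K *m invmx K = 1 gives B T = 0 and
   (A - k^2 M) T = 1 - B^T Y, and multiplying the latter by C^T on the left
   identifies Y = L^-1 C^T.  Hence W T = 1 - B^T L^-1 C^T, while
   W C = (eta - k^2) B^T, so T + (eta - k^2)^-1 C L^-1 C^T is an inverse of W. *)
Require Import Defs.
From mathcomp Require Import all_boot all_order all_algebra.
From mathcomp Require Import reals.
Set Implicit Arguments.
Unset Strict Implicit.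
Unset Printing Implicit Defensive.
Import Order.TTheory GRing.Theory Num.Theory.
Local Open Scope ring_scope.

Lemma mulmx_colker_basis (F : fieldType) (m n p : nat) (A : 'M[F]_(p, n))
    (C : 'M[F]_(n, m)) :
  basis_of (colker A) [seq col j C | j : 'I_m] -> A *m C = 0.
Proof.
move=> hC; apply/matrixP => i j.
have: col j C \in colker A.
  by rewrite (basis_mem hC) //; apply/imageP; exists j.
rewrite memv_ker lfunE /= => /eqP/(congr1 (fun v : 'cV_p => v i 0)).
rewrite !mxE => sum0; rewrite -[RHS]sum0.
by apply: eq_bigr => l _; rewrite mxE.
Qed.

(** Since [kermx] is a left kernel, the argument passes to [L^T]: each row of [kermx L^T],
    transposed, is a vector killed by [L], hence zero. *)
Lemma unitmx_cV_inj (F : fieldType) (m : nat) (L : 'M[F]_m) :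
  (forall x : 'cV_m, L *m x = 0 -> x = 0) -> L \in unitmx.
Proof.
move=> injL; rewrite -unitmx_tr -row_free_unit -kermx_eq0.
apply/eqP/row_matrixP => i; rewrite row0; apply: trmx_inj; rewrite trmx0.
apply: injL; apply: trmx_inj.
by rewrite trmx_mul trmxK -row_mul mulmx_ker row0 trmx0.
Qed.

(** If [B C x = 0], then [(C x)^T M (C x) = x^T B C x = 0], so [C x = 0] by definiteness. Then
    [B^T x = M C x = 0], and independence of the rows of [B] gives [x = 0]. *)
Lemma sym_posdef_compression_unitmx (R : numFieldType) (m n : nat)
    (M : 'M[R]_n) (B : 'M[R]_(m, n)) (C : 'M[R]_(n, m)) :
  sym_posdef M -> row_free B -> M *m C = B^T -> B *m C \in unitmx.
Proof.
move=> [symM posM] freeB hMC; apply: unitmx_cV_inj => x Lx0.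
have Cx0 : C *m x = 0.
  apply/eqP/negP => /negP /posM.
  rewrite -{1}symM -trmx_mul (mulmxA M) hMC trmx_mul trmxK -!mulmxA.
  by rewrite (mulmxA B) Lx0 mulmx0 mxE ltxx.
apply: trmx_inj; apply: (row_free_inj freeB); apply: trmx_inj.
by rewrite /= !trmx_mul !trmxK -hMC -!mulmxA Cx0 !mulmx0.
Qed.

Theorem corollary2p1 (R : realType) (m n : nat) (hmn : (m <= n)%N) (k : R)
    (A M : 'M[R]_n) (B : 'M[R]_(m, n)) (C : 'M[R]_(n, m)) (L : 'M[R]_m)
    (K : 'M[R]_(n + m)) (T : 'M[R]_n)
    (hA : sym_possemidef A) (hkerA : \dim (colker A) = m)
    (hM : sym_posdef M)
    (hB : row_free B)
    (hC : basis_of (colker A) [seq col j C | j : 'I_m])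
    (hMC : M *m C = B^T)
    (hL : L = B *m C)
    (hK : K = saddle_mx k A M B)
    (hKunit : K \in unitmx)
    (hAMunit : A - k ^+ 2 *: M \in unitmx)
    (hT : T = ulsubmx (invmx K))
    (eta : R) (heta : eta != k ^+ 2) :
  let W := A + eta *: (B^T *m invmx L *m B) - k ^+ 2 *: M in
  [/\ L \in unitmx, W \in unitmx,
      T = invmx W *m (1%:M - B^T *m invmx L *m C^T)
    & T = invmx W - (eta - k ^+ 2)^-1 *: (C *m invmx L *m C^T)].
Proof.
move=> W; have AC0 := mulmx_colker_basis hC.
have CA0 : C^T *m A = 0 by rewrite -(proj1 hA) -trmx_mul AC0 trmx0.
have CM : C^T *m M = B by rewrite -(proj1 hM) -trmx_mul hMC trmxK.
have Lu : L \in unitmx by rewrite hL (sym_posdef_compression_unitmx hM hB hMC).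
have CB : C^T *m B^T = L by rewrite -hMC mulmxA CM hL.
have s0 : eta - k ^+ 2 != 0 by rewrite subr_eq0.
(* [A] kills [C], and [B^T L^-1 B C] collapses to [B^T] because [B C = L]. *)
have WC : W *m C = (eta - k ^+ 2) *: B^T.
  rewrite mulmxBl mulmxDl AC0 add0r -!scalemxAl hMC scalerBl.
  by rewrite -!mulmxA -hL mulVmx // mulmx1.
set Y := dlsubmx (invmx K).
have [DT BT] : (A - k ^+ 2 *: M) *m T + B^T *m Y = 1%:M /\ B *m T = 0.
  have := mulmxV hKunit; rewrite {1}hK -[invmx K]submxK -hT -/Y.
  rewrite mulmx_block mul0mx addr0 scalar_mx_block.
  by move=> /eq_block_mx[].
(* Multiplying [DT] by [C^T] removes its first term, as [C^T A = 0] and [C^T M T = B T = 0]; what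
   remains is [L Y = C^T]. *)
have YE : Y = invmx L *m C^T.
  apply: (can_inj (mulKmx Lu)); rewrite mulKVmx //.
  move: (congr1 (mulmx C^T) DT); rewrite mulmxDr mulmx1 !mulmxA CB.
  by rewrite mulmxBr CA0 -scalemxAr CM sub0r mulNmx -scalemxAl BT scaler0 oppr0 add0r.
(* The [eta] term of [W] vanishes on [T] because [B T = 0]. *)
have WT : W *m T = 1%:M - B^T *m invmx L *m C^T.
  rewrite /W addrAC mulmxDl -scalemxAl -!mulmxA BT !mulmx0 scaler0 addr0.
  by rewrite -YE -DT addrK.
(* By [WC], the added term contributes exactly the [B^T L^-1 C^T] that [W T] lacks from the
   identity. *)
have WS : W *m (T + (eta - k ^+ 2)^-1 *: (C *m invmx L *m C^T)) = 1%:M.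
  rewrite mulmxDr WT -scalemxAr !mulmxA WC -!scalemxAl scalerA mulVf //.
  by rewrite scale1r subrK.
(* For square matrices a right inverse suffices, so [W] is nonsingular for every [eta] other than
   [k^2]. *)
have [Wu _] := mulmx1_unit WS.
split=> //; first by rewrite -WT mulKmx.
by rewrite -[invmx W]mulmx1 -WS mulKmx // addrK.
Qed.
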